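(* The arithmetic inverse monoid $\mathcal A$ (the inverse subsemigroup of $\mathcal I(\mathbb N)$ generated by $\{R_{a,b}:a>b\in\mathbb N\}$) is characterised as the inverse monoid whose non-zero elements map between congruence classes in a monotone manner: the non-zero elements of $\mathcal A$ are precisely the monotone partial injections $f\in\mathcal I(\mathbb N)$ whose domain is a congruence class $a\mathbb N+b$ and whose image is a congruence class $c\mathbb N+d$, for some $a>b$, $c>d\in\mathbb N$. Consequently, the non-zero idempotents of $\mathcal A$ are precisely the partial identities $Id_{a\mathbb N+b}$ on congruence classes ($a>b\in\mathbb N$).
   Context: $\mathbb N=\{0,1,2,\dots\}$. $\mathcal I(\mathbb N)$ is the symmetric inverse monoid on $\mathbb N$: all partial injections $\mathbb N\to\mathbb N$ under composition of partial functions, with generalised inverse $f^\ddagger(y)=x$ iff $f(x)=y$; its zero element $\epsilon$ is the nowhere-defined partial function. For $a>b\in\mathbb N$, the congruence class of $b$ modulo $a$ is $a\mathbb N+b=\{an+b:n\in\mathbb N\}$, and $R_{a,b}\in\mathcal I(\mathbb N)$ is the partial injection with domain $a\mathbb N+b$ given by $R_{a,b}(n)=\frac{n-b}{a}$. For $S\subseteq\mathbb N$, $Id_S$ is the partial identity with domain $S$. A partial injection $f$ is monotone if $x\le y$ implies $f(x)\le f(y)$ whenever both are defined. *)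

(* Defs.v *)
From mathcomp Require Import all_boot.
From mathcomp Require Import boolp classical_sets.

Set Implicit Arguments.
Unset Strict Implicit.
Unset Printing Implicit Defensive.

Local Open Scope classical_set_scope.

Record partial_injection := PartialInjection {
  pi_fun :> nat -> option nat;
  pi_fun_inj : forall x y z, pi_fun x = Some z -> pi_fun y = Some z -> x = y }.

Lemma partial_injection_eq (f g : partial_injection) :
  (forall x, f x = g x) -> f = g.
Proof.
case: f g => f Hf [g Hg] /= /funext E; case: _ / E Hg => Hg.
by rewrite (Prop_irrelevance Hf Hg).
Qed.

Definition pi_dom (f : partial_injection) : set nat :=
  [set x | exists y, f x = Some y].

Definition pi_img (f : partial_injection) : set nat :=
  [set y | exists x, f x = Some y].

Definition pi_monotone (f : partial_injection) : Prop :=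
  forall x y x' y', f x = Some x' -> f y = Some y' -> x <= y -> x' <= y'.

Lemma pi_comp_subproof (f g : partial_injection) x y z :
  obind f (g x) = Some z -> obind f (g y) = Some z -> x = y.
Proof.
case gx: (g x) => [u|//]; case gy: (g y) => [v|//] /= fu fv.
by move: gx; rewrite (pi_fun_inj fu fv) => gx; exact: pi_fun_inj gx gy.
Qed.

(* [pi_comp f g] applies [g] first. *)
Definition pi_comp (f g : partial_injection) : partial_injection :=
  PartialInjection (@pi_comp_subproof f g).

Definition pi_inv_fun (f : partial_injection) (y : nat) : option nat :=
  match pselect (exists x, f x = Some y) with
  | left h => Some (projT1 (cid h))
  | right _ => None
  end.

Lemma pi_inv_funP (f : partial_injection) x y :
  pi_inv_fun f y = Some x <-> f x = Some y.
Proof.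
rewrite /pi_inv_fun; case: pselect => [h|nh]; last first.
  by split=> // fx; case: nh; exists x.
case: cid => w fw /=; split=> [[<-] //|fx].
by rewrite (pi_fun_inj fw fx).
Qed.

Lemma pi_inv_subproof (f : partial_injection) x y z :
  pi_inv_fun f x = Some z -> pi_inv_fun f y = Some z -> x = y.
Proof. by move=> /pi_inv_funP fz /pi_inv_funP; rewrite fz => -[]. Qed.

Definition pi_inv (f : partial_injection) : partial_injection :=
  PartialInjection (@pi_inv_subproof f).

Lemma pi_zero_subproof (x y z : nat) :
  None = Some z -> None = Some z -> x = y.
Proof. by []. Qed.

Definition pi_zero : partial_injection :=
  @PartialInjection (fun=> None) pi_zero_subproof.

Lemma pi_id_subproof (S : set nat) (x y z : nat) :
  (if x \in S then Some x else None) = Some z ->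
  (if y \in S then Some y else None) = Some z -> x = y.
Proof. by case: ifP => // _ [->]; case: ifP => // _ [->]. Qed.

Definition pi_id (S : set nat) : partial_injection :=
  @PartialInjection (fun x => if x \in S then Some x else None)
    (@pi_id_subproof S).

Definition congruence_class (a b : nat) : set nat :=
  [set a * n + b | n in [set: nat]].

Lemma residue_map_subproof (a b x y z : nat) :
  (if x \in congruence_class a b then Some ((x - b) %/ a) else None) = Some z ->
  (if y \in congruence_class a b then Some ((y - b) %/ a) else None) = Some z ->
  x = y.
Proof.
case: ifP => // /set_mem[m _ <-]; case: ifP => // /set_mem[n _ <-].
rewrite !addnK; case: a => [|a]; first by rewrite !mul0n.
by rewrite !mulKn // => -[->] [->].
Qed.

(* The map R_{a,b}; it is only meant for b < a, and on its domain the
   truncated subtraction and the division are exact. *)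
Definition residue_map (a b : nat) : partial_injection :=
  @PartialInjection
    (fun x => if x \in congruence_class a b then Some ((x - b) %/ a) else None)
    (@residue_map_subproof a b).

Definition inverse_subsemigroup (M : set partial_injection) : Prop :=
  (forall f g, M f -> M g -> M (pi_comp f g)) /\ (forall f, M f -> M (pi_inv f)).

Definition inverse_submonoid (M : set partial_injection) : Prop :=
  inverse_subsemigroup M /\ M (pi_id [set: nat]).

Definition arithmetic_monoid : set partial_injection :=
  smallest inverse_subsemigroup
    [set f | exists a b, b < a /\ f = residue_map a b].

(* Main.v *)
(** A monotone bijection between two congruence classes has no gaps, so it must
    be [a n + b |-> c n + d], which is [R_{c,d}^-1 R_{a,b}].  Conversely the
    generators have this form, inversion swaps the two classes, and the product
    of two such maps is either empty or again of this form, because two classes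
    that meet do so in a class modulo the lcm of their moduli. *)
Require Import Defs.
From mathcomp Require Import all_boot.
From mathcomp Require Import boolp classical_sets.
From mathcomp Require Import zify.

Set Implicit Arguments.
Unset Strict Implicit.
Unset Printing Implicit Defensive.

Local Open Scope classical_set_scope.

(** The graph of [f] is that of [a n + b |-> c n + d]. Fixing the whole graph also makes [f]
    undefined elsewhere and treats the two classes symmetrically. *)
Definition maps_classes (f : partial_injection) (a b c d : nat) : Prop :=
  forall x y, f x = Some y <-> exists n, x = a * n + b /\ y = c * n + d.

(** * Graphs of inverses, composites and the zero map *)

Lemma pi_invP (f : partial_injection) x y :
  pi_inv f y = Some x <-> f x = Some y.
Proof. exact: pi_inv_funP. Qed.

Lemma pi_compP (f g : partial_injection) x z :
  pi_comp f g x = Some z <-> exists2 y, g x = Some y & f y = Some z.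
Proof.
split=> /=; first by case: (g x) => [y|//] fy; exists y.
by move=> [y -> fy].
Qed.

Lemma pi_ext (f g : partial_injection) :
  (forall x y, f x = Some y <-> g x = Some y) -> f = g.
Proof.
move=> fg; apply: partial_injection_eq => x.
case gx: (g x) => [y|]; first exact/fg.
by case fx: (f x) => [y|//]; move/fg: fx; rewrite gx.
Qed.

Lemma pi_eq0 (f : partial_injection) :
  f = pi_zero <-> forall x y, f x <> Some y.
Proof.
split=> [-> //|f0]; apply: pi_ext => x y; split=> // fxy.
by case: (f0 _ _ fxy).
Qed.

(** * Congruence classes and their intersections *)

Lemma congruence_classP a b x :
  congruence_class a b x <-> exists n, x = a * n + b.
Proof.
by split=> [[n _ <-]|[n ->]]; exists n.
Qed.

Lemma congruence_class_modn a b x :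
  b < a -> congruence_class a b x <-> x %% a = b.
Proof.
move=> ba; rewrite congruence_classP; split=> [[n ->]|<-].
  by rewrite mulnC modnMDl modn_small.
by exists (x %/ a); rewrite mulnC -divn_eq.
Qed.

Lemma eqn_mod_lcm a c x y :
  (x == y %[mod lcmn a c]) = (x == y %[mod a]) && (x == y %[mod c]).
Proof.
(* For [y <= x] each congruence says that the modulus divides [x - y], and an lcm divides a number
   iff both of its arguments do. *)
wlog yx : x y / y <= x => [le_case|].
  have [/le_case//|/ltnW/le_case] := leqP y x.
  by rewrite eq_sym => ->; rewrite !(eq_sym (y %% _)).
by rewrite !eqn_mod_dvd // dvdn_lcm.
Qed.

(** The common point [x0] represents both classes, so lying in both means being congruent to [x0]
    modulo [a] and modulo [c], that is, modulo their lcm. *)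
Lemma congruence_classI a b c d x0 :
  b < a -> d < c -> congruence_class a b x0 -> congruence_class c d x0 ->
  congruence_class a b `&` congruence_class c d =
    congruence_class (lcmn a c) (x0 %% lcmn a c).
Proof.
move=> ba dc /(congruence_class_modn x0 ba) xb /(congruence_class_modn x0 dc) xd.
have l0 : 0 < lcmn a c by rewrite lcmn_gt0; lia.
rewrite predeqE => x /=; rewrite !congruence_class_modn ?ltn_pmod // -xb -xd.
split=> [[/eqP xa /eqP xc]|/eqP]; first by apply/eqP; rewrite eqn_mod_lcm xa.
by rewrite eqn_mod_lcm => /andP[/eqP xa /eqP xc].
Qed.

(** * Affine maps between congruence classes *)

Lemma maps_classes_inj f g a b c d :
  maps_classes f a b c d -> maps_classes g a b c d -> f = g.
Proof. by move=> fP gP; apply: pi_ext => x y; rewrite fP gP. Qed.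

(** The image is all of N, written as the class of [0] modulo [1]. *)
Lemma maps_classes_residue_map a b :
  b < a -> maps_classes (residue_map a b) a b 1 0.
Proof.
move=> ba x y /=; have a0 : 0 < a by lia.
split=> [|[n [-> ->]]].
  case: ifP => // /set_mem/congruence_classP[n ->] [<-].
  by exists n; rewrite addnK mulKn // mul1n addn0.
rewrite mem_set; last by apply/congruence_classP; exists n.
by rewrite addnK mulKn // mul1n addn0.
Qed.

Lemma maps_classes_inv f a b c d :
  maps_classes f a b c d -> maps_classes (pi_inv f) c d a b.
Proof.
by move=> fP x y; rewrite pi_invP fP; split=> -[n [-> ->]]; exists n.
Qed.

Lemma maps_classes_comp_eq f g a b c d p q :
  0 < p -> maps_classes f p q c d -> maps_classes g a b p q ->
  maps_classes (pi_comp f g) a b c d.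
Proof.
move=> p0 fP gP x z; rewrite pi_compP; split.
  move=> [y /gP[n [-> ->]] /fP[m [+ ->]]].
  by move=> /addIn/eqP; rewrite eqn_pmul2l // => /eqP <-; exists n.
by move=> [n [-> ->]]; exists (p * n + q); [apply/gP | apply/fP]; exists n.
Qed.

(** The intermediate values form the class [l k + s] where the image of [g] meets the domain of [f].
    Both the parameter of [g] and that of [f] are then affine in [k], hence so are argument and
    value of the composite. *)
Lemma maps_classes_comp f g a b c d a' b' c' d' :
  b < a -> d < c -> b' < a' -> d' < c' ->
  maps_classes g a b c d -> maps_classes f a' b' c' d' ->
  pi_comp f g <> pi_zero ->
  exists p q r s, [/\ q < p, s < r & maps_classes (pi_comp f g) p q r s].
Proof.
move=> ba dc ba' dc' gP fP fg0.
have [x [z /pi_compP[y gxy fyz]]] : exists x z, pi_comp f g x = Some z.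
  by apply: contrapT => h; apply/fg0/pi_eq0 => x z fgx; apply: h; exists x, z.
have yc : congruence_class c d y.
  by move/gP: gxy => [n [_ ->]]; apply/congruence_classP; exists n.
have ya : congruence_class a' b' y.
  by move/fP: fyz => [n [-> _]]; apply/congruence_classP; exists n.
have := congruence_classI dc ba' yc ya.
set l := lcmn c a'; set s := y %% l => cap.
have l0 : 0 < l by rewrite lcmn_gt0; lia.
have sl : s < l by rewrite ltn_pmod.
have capP u : (exists k, u = l * k + s) <->
    (exists n, u = c * n + d) /\ (exists m, u = a' * m + b').
  by rewrite -!congruence_classP -cap.
(* The case [k = 0]: the point [s] itself fixes the offsets [n0] and [m0] of the two parameters. *)
have [[n0 sn0] [m0 sm0]] : (exists n, s = c * n + d) /\
    (exists m, s = a' * m + b') by apply/capP; exists 0; rewrite muln0.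
have [lc lc_eq] : exists e, l = c * e.
  by have /dvdnP[e ->] : c %| l := dvdn_lcml c a'; exists e; rewrite mulnC.
have [la la_eq] : exists e, l = a' * e.
  by have /dvdnP[e ->] : a' %| l := dvdn_lcmr c a'; exists e; rewrite mulnC.
(* Both bounds come from [s < l]; they keep the new residues below the new moduli. *)
have n0lc : n0 < lc by rewrite -(@ltn_pmul2l c) -?lc_eq; lia.
have m0la : m0 < la by rewrite -(@ltn_pmul2l a') -?la_eq; lia.
exists (a * lc), (a * n0 + b), (c' * la), (c' * m0 + d').
split; [nia|nia|move=> u w; rewrite pi_compP; split].
- move=> [v /gP[n [-> vn]] /fP[m [vm ->]]].
  have [k vk] : exists k, v = l * k + s.
    by apply/capP; split; [exists n | exists m].
  (* Cancel [c] in [c n + d = l k + s], using [l = c lc] and [s = c n0 + d]; likewise [a'] for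
     [m]. *)
  have -> : n = lc * k + n0.
    by apply/eqP; rewrite -(@eqn_pmul2l c); [apply/eqP; nia | lia].
  have -> : m = la * k + m0.
    by apply/eqP; rewrite -(@eqn_pmul2l a'); [apply/eqP; nia | lia].
  by exists k; nia.
- move=> [k [-> ->]]; exists (l * k + s).
    by apply/gP; exists (lc * k + n0); nia.
  by apply/fP; exists (la * k + m0); nia.
Qed.

(** * Monotone bijections between congruence classes *)

Lemma homo_surj_id (h : nat -> nat) :
  {homo h : m n / m < n} -> (forall k, exists n, h n = k) -> h =1 id.
Proof.
move=> h_mono h_surj; elim/ltn_ind => n IHn.
have le_h m : m <= h m.
  by elim: m => // m IHm; apply: leq_ltn_trans IHm (h_mono _ _ _).
apply/eqP; rewrite eqn_leq le_h andbT leqNgt; apply/negP => n_lt.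
(* If [n < h n], the value [n] would be skipped: smaller arguments are fixed by induction, and
   larger ones have values above [h n]. *)
have [m hm] := h_surj n; have [mn|nm|mn] := ltngtP m n.
- by move: (IHn m mn); lia.
- by move: (h_mono _ _ nm); lia.
- by move: n_lt; rewrite -mn hm; lia.
Qed.

Lemma monotone_maps_classes f a b c d :
  b < a -> d < c -> pi_monotone f ->
  pi_dom f = congruence_class a b -> pi_img f = congruence_class c d ->
  maps_classes f a b c d.
Proof.
move=> ba dc f_mono f_dom f_img.
have f_ex n : exists m, f (a * n + b) = Some (c * m + d).
  have [y fy] : pi_dom f (a * n + b).
    by rewrite f_dom; apply/congruence_classP; exists n.
  have : pi_img f y by exists (a * n + b).
  by rewrite f_img => /congruence_classP[m ym]; exists m; rewrite fy ym.
(* [h] is [f] read in the parameters of the two classes. *)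
have [h hP] := choice f_ex.
have h_id : h =1 id.
  apply: homo_surj_id => [m n mn|k].
    have /= := f_mono _ _ _ _ (hP m) (hP n).
    (* Injectivity of [f] turns monotonicity into strict monotonicity. *)
    have neq : h m <> h n.
      move=> hmn; have := hP n; rewrite -hmn => /(pi_fun_inj (hP m)); nia.
    by nia.
  have [x fx] : pi_img f (c * k + d).
    by rewrite f_img; apply/congruence_classP; exists k.
  have : pi_dom f x by exists (c * k + d).
  rewrite f_dom => /congruence_classP[n xn]; exists n.
  by move: fx; rewrite xn hP => -[]; nia.
move=> x y; split=> [fxy|[n [-> ->]]]; last by rewrite hP h_id.
have : pi_dom f x by exists y.
rewrite f_dom => /congruence_classP[n xn]; exists n; split=> //.
by move: fxy; rewrite xn hP h_id => -[].
Qed.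

Lemma maps_classes_monotone f a b c d :
  b < a -> maps_classes f a b c d -> pi_monotone f.
Proof.
move=> ba fP x y x' y' /fP[m [-> ->]] /fP[n [-> ->]] le_mn.
have mn : m <= n by nia.
by rewrite leq_add2r leq_mul2l mn orbT.
Qed.

Lemma maps_classes_dom f a b c d :
  maps_classes f a b c d -> pi_dom f = congruence_class a b.
Proof.
move=> fP; rewrite predeqE => x; rewrite congruence_classP.
split=> [[y /fP[n [-> _]]]|[n ->]]; first by exists n.
by exists (c * n + d); apply/fP; exists n.
Qed.

Lemma maps_classes_img f a b c d :
  maps_classes f a b c d -> pi_img f = congruence_class c d.
Proof.
move=> fP; rewrite predeqE => y; rewrite congruence_classP.
split=> [[x /fP[n [_ ->]]]|[n ->]]; first by exists n.
by exists (a * n + b); apply/fP; exists n.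
Qed.

Lemma maps_classes_neq0 f a b c d : maps_classes f a b c d -> f <> pi_zero.
Proof.
move=> fP /pi_eq0 f0; apply: (f0 (a * 0 + b) (c * 0 + d)).
by apply/fP; exists 0.
Qed.

(** * Partial identities and idempotents *)

Lemma pi_idP (S : set nat) x y : pi_id S x = Some y <-> S x /\ y = x.
Proof.
split=> /= [|[Sx ->]]; last by rewrite mem_set.
by case: ifP => // /set_mem Sx [<-].
Qed.

Lemma maps_classes_id a b : maps_classes (pi_id (congruence_class a b)) a b a b.
Proof.
move=> x y; rewrite pi_idP congruence_classP.
by split=> [[[n ->] ->]|[n [-> ->]]]; [exists n | split=> //; exists n].
Qed.

Lemma idempotentE (f : partial_injection) :
  pi_comp f f = f <-> f = pi_id (pi_dom f).
Proof.
split=> [ff|->].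
  apply: pi_ext => x y; rewrite pi_idP.
  (* Idempotence gives [f v = Some v] as well, so [u] and [v] share a value and injectivity
     identifies them. *)
  have f_fix u v : f u = Some v -> v = u.
    move=> fuv; move: (fuv); rewrite -{1}ff => /pi_compP[w].
    by rewrite fuv => -[<-] /(pi_fun_inj fuv).
  split=> [fxy|[[z fxz] ->]]; first by split; [exists y | exact: f_fix].
  by move: (fxz); rewrite (f_fix _ _ fxz).
apply: pi_ext => x y; rewrite pi_compP; split=> [[z]|].
  by move=> /pi_idP[_ ->].
by move=> /pi_idP[Sx ->]; exists x; apply/pi_idP.
Qed.

(** * Elements generated by the residue maps *)

Lemma arithmetic_monoid_subsemigroup : inverse_subsemigroup arithmetic_monoid.
Proof.
split=> [f g Af Ag|f Af] M MP; have [[Mcomp Minv] _] := MP.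
  exact: Mcomp (Af M MP) (Ag M MP).
exact: Minv (Af M MP).
Qed.

Lemma residue_map_arithmetic a b : b < a -> arithmetic_monoid (residue_map a b).
Proof. by move=> ba M [_ genM]; apply: genM; exists a, b. Qed.

Lemma maps_classes_arithmetic f a b c d :
  b < a -> d < c -> maps_classes f a b c d -> arithmetic_monoid f.
Proof.
move=> ba dc fP.
have [Acomp Ainv] := arithmetic_monoid_subsemigroup.
have -> : f = pi_comp (pi_inv (residue_map c d)) (residue_map a b).
  apply: maps_classes_inj fP _.
  apply: maps_classes_comp_eq (maps_classes_residue_map ba) => //.
  exact/maps_classes_inv/maps_classes_residue_map.
by apply: Acomp; [apply: Ainv|]; apply: residue_map_arithmetic.
Qed.

Lemma arithmetic_maps_classes f :
  arithmetic_monoid f -> f <> pi_zero ->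
  exists a b c d, [/\ b < a, d < c & maps_classes f a b c d].
Proof.
(* Zero has to belong to [M], since the product of two class maps can be empty; minimality of the
   generated subsemigroup then applies to [M]. *)
pose M : set partial_injection := [set f | f <> pi_zero ->
  exists a b c d, [/\ b < a, d < c & maps_classes f a b c d]].
have Minv : inverse_subsemigroup M.
  split=> [g h Mg Mh gh0|g Mg g'0].
    have [|a' [b' [c' [d' [ba' dc' gP]]]]] := Mg.
      by move=> /pi_eq0 g0; apply/gh0/pi_eq0 => x z /pi_compP[y _ /g0].
    have [|a [b [c [d [ba dc hP]]]]] := Mh.
      by move=> /pi_eq0 h0; apply/gh0/pi_eq0 => x z /pi_compP[y /h0].
    exact: maps_classes_comp hP gP gh0.
  have [|a [b [c [d [ba dc gP]]]]] := Mg.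
    by move=> /pi_eq0 g0; apply/g'0/pi_eq0 => x y /pi_invP/g0.
  by exists c, d, a, b; split=> //; apply: maps_classes_inv.
apply: (smallest_sub Minv) => _ [a [b [ba ->]]] _.
by exists a, b, 1, 0; split=> //; apply: maps_classes_residue_map.
Qed.

Theorem corollary25 :
  inverse_submonoid arithmetic_monoid /\
  (forall f : partial_injection,
    (arithmetic_monoid f /\ f <> pi_zero) <->
    (pi_monotone f /\
     (exists a b, b < a /\ pi_dom f = congruence_class a b) /\
     (exists c d, d < c /\ pi_img f = congruence_class c d))) /\
  (forall f : partial_injection,
    (arithmetic_monoid f /\ f <> pi_zero /\ pi_comp f f = f) <->
    (exists a b, b < a /\ f = pi_id (congruence_class a b))).
Proof.
split.
  split; first exact: arithmetic_monoid_subsemigroup.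
  (* The identity maps the class of [0] modulo [1], which is N, to itself. *)
  apply: (@maps_classes_arithmetic _ 1 0 1 0) => // x y.
  rewrite pi_idP; split=> [[_ ->]|[n [-> ->]]] //.
  by exists x; rewrite mul1n addn0.
split=> f; split.
- move=> [Af f0]; have [a [b [c [d [ba dc fP]]]]] := arithmetic_maps_classes Af f0.
  split; first exact: maps_classes_monotone fP.
  split; first by exists a, b; split=> //; apply: maps_classes_dom fP.
  by exists c, d; split=> //; apply: maps_classes_img fP.
- move=> [f_mono [[a [b [ba f_dom]]] [c [d [dc f_img]]]]].
  have fP := monotone_maps_classes ba dc f_mono f_dom f_img.
  by split; [apply: maps_classes_arithmetic fP | apply: maps_classes_neq0 fP].
- move=> [Af [f0 /idempotentE ff]].
  have [a [b [c [d [ba dc fP]]]]] := arithmetic_maps_classes Af f0.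
  by exists a, b; split=> //; rewrite -(maps_classes_dom fP).
- move=> [a [b [ba ->]]]; have idP := maps_classes_id a b.
  split; first exact: maps_classes_arithmetic idP.
  split; first exact: maps_classes_neq0 idP.
  by apply/idempotentE; rewrite (maps_classes_dom idP).
Qed.
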